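(* The following three equivalences hold. (1) There exists a Seidel matrix with spectrum $\{ [-5]^{42}, [11]^{15}, [15]^3 \}$ if and only if there exists a graph with spectrum $\{ [22]^1, [2]^{42}, [-6]^{15}, [-8]^2 \}$. (2) There exists a Seidel matrix with spectrum $\{ [-5]^{53}, [13]^{16}, [19]^3 \}$ if and only if there exists a graph with spectrum $\{ [26]^1, [2]^{53}, [-7]^{16}, [-10]^2 \}$. (3) There exists a Seidel matrix with spectrum $\{ [-5]^{70}, [13]^{5}, [19]^{15} \}$ if and only if there exists a graph with spectrum $\{ [38]^1, [2]^{70}, [-7]^{4}, [-10]^{15} \}$.
   Context: A Seidel matrix is a symmetric $\{0,\pm1\}$-matrix with zero diagonal and all off-diagonal entries nonzero. The notation $\{[\theta_1]^{m_1},\dots,[\theta_r]^{m_r}\}$ for the spectrum of a real symmetric matrix means that its distinct eigenvalues are $\theta_1,\dots,\theta_r$, with $\theta_i$ having multiplicity $m_i$. Graphs are finite, simple and undirected, and the spectrum of a graph is the spectrum of its adjacency matrix. *)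

(* Defs.v *)
(* The real numbers are an arbitrary [realType]. *)
From mathcomp Require Import all_boot all_order all_algebra.
From mathcomp Require Import reals.

Set Implicit Arguments.
Unset Strict Implicit.
Unset Printing Implicit Defensive.

Import GRing.Theory.
Local Open Scope ring_scope.

Definition seidel_matrix (R : realType) (n : nat) (S : 'M[R]_n) : Prop :=
  [/\ S^T = S,
      forall i j, S i j \in [:: 0; 1; -1],
      forall i, S i i = 0
    & forall i j, i != j -> S i j != 0].

(* [s] lists the distinct eigenvalues of [A], each paired with the dimension
   of its eigenspace.  [eigenspace] consists of left (row) eigenvectors, and
   its rank is the geometric multiplicity; for the real symmetric matrices
   considered here this is the same as right eigenvectors and algebraic
   multiplicity, and the multiplicities automatically add up to [n]. *)
Definition has_spectrum (R : realType) (n : nat) (A : 'M[R]_n)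
    (s : seq (R * nat)) : Prop :=
  [/\ uniq (unzip1 s),
      forall a : R, eigenvalue A a = (a \in unzip1 s)
    & forall (a : R) (m : nat), (a, m) \in s -> \rank (eigenspace A a) = m].

Record sgraph := SGraph {
  vertex :> finType;
  edge : rel vertex;
  edge_sym : symmetric edge;
  edge_irrefl : irreflexive edge }.

(* Rows and columns are indexed by the enumeration of the vertex type. *)
Definition adjacency_matrix (R : realType) (G : sgraph) : 'M[R]_#|G| :=
  \matrix_(i, j) (edge (enum_val i) (enum_val j))%:R.

Arguments adjacency_matrix R G : clear implicits.

(* Main.v *)
(** The Seidel matrix S = J - I - 2A of a k-regular graph on n vertices has
    eigenvalue n - 1 - 2k on the all-ones vector, and -1 - 2a on the part of the
    a-eigenspace of A orthogonal to it.  The graphs at hand are regular: with k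
    the largest eigenvalue, the sum of the entries of A is tr (A^2) = n k, so
    the all-ones vector attains the maximum of the Rayleigh quotient.

    Conversely a Seidel matrix S with eigenvalues -5, b, t comes from a regular
    graph as soon as its t-eigenspace contains a +-1 vector, after switching
    with respect to it.  The matrix (S + 5)(S - b) is a multiple of the
    projection onto this eigenspace and all its entries are even, so that
    (+ or -) half of it is the integral Gram matrix of a tight frame
    v_1, ..., v_n of vectors of squared norm d <= 3.  Moreover the residue
    modulo 4 of the row sums of S splits the indices into two classes that determine the
    parity of the inner products.  The tight frame identity
    sum_k <x, v_k>^2 = c <x, x>, applied to small combinations x of the v_i,
    then forces a rigid structure, and exhibits an x all of whose inner products
    with the v_k have the same absolute value:
    - n = 60: the v_i lie on three orthogonal lines, x = v_i + v_j + v_k;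
    - n = 72: x = v_i - <v_i, v_j> v_j for any two non-parallel vectors of the
      same class, so that <v_i, v_j> = +-1;
    - n = 90: the v_i lie on ten equiangular lines, four of which can be
      oriented so that all their inner products are 1, and
      x = 2 v_i - v_j - v_k - v_l. *)
Require Import Defs.
From mathcomp Require Import all_boot all_order all_algebra.
From mathcomp Require Import reals complex.
From mathcomp Require Import zify ring lra.

Set Implicit Arguments.
Unset Strict Implicit.
Unset Printing Implicit Defensive.

Import Order.TTheory GRing.Theory Num.Theory.
Local Open Scope ring_scope.

(** * Spectra of real symmetric matrices *)

Lemma row_eigenspace_diag (F : fieldType) n (P A : 'M[F]_n) (d : 'rV_n) i :
  P \in unitmx -> A = invmx P *m diag_mx d *m P ->
  (row i P <= eigenspace A (d 0 i))%MS.
Proof.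
move=> uP defA; apply/eigenspaceP; rewrite {}defA rowE !mulmxA mulmxK //.
by rewrite -[_ *m diag_mx d]rowE row_diag_mx -scalemxAl.
Qed.

Lemma sub_sum_eigenspace_diag (F : fieldType) n (P A : 'M[F]_n) (d : 'rV_n) :
  P \in unitmx -> A = invmx P *m diag_mx d *m P ->
  (1%:M <= \sum_i eigenspace A (d 0 i))%MS.
Proof.
move=> uP defA; have : (1%:M <= P)%MS by rewrite sub1mx row_full_unit.
move=> /submx_trans; apply; apply/row_subP => i.
by rewrite (sumsmx_sup i) // row_eigenspace_diag.
Qed.

Lemma sum_rank_eigenspace_le (F : fieldType) n (A : 'M[F]_n) (rs : seq F) :
  uniq rs -> (\sum_(a <- rs) \rank (eigenspace A a) <= n)%N.
Proof.
move=> urs; rewrite (big_nth 0) big_mkord.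
have dx : mxdirect (\sum_(i < size rs) eigenspace A rs`_i).
  apply: mxdirect_sum_eigenspace => i j _ _ rsij; apply/val_inj.
  by apply: uniqP rsij; rewrite ?inE.
by move/mxdirectP: dx => /= <-; apply: rank_leq_col.
Qed.

(** The spectral theorem is applied over [R[i]], where a real symmetric matrix is Hermitian; its
    spectral values are real, and inclusion of row spaces descends to [R]. *)
Lemma real_symmetric_sum_eigenspace (R : rcfType) n (A : 'M[R]_n) (s : seq R) :
  A^T = A -> (forall a, eigenvalue A a -> a \in s) ->
  (1%:M <= \sum_(a <- s) eigenspace A a)%MS.
Proof.
move=> symA eigA; pose f := real_complex R; pose C := map_mx f A.
have hermC : C \is hermsymmx.
  apply/is_hermitianmxP; rewrite expr0 scale1r.
  apply/matrixP=> i j; rewrite !mxE -{1}symA mxE.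
  exact: (esym (conjc_real _)).
have /hermitian_normalmx/orthomx_spectralP defC := hermC.
have := sub_sum_eigenspace_diag (spectral_unit C) defC.
set d := spectral_diag C => sC.
rewrite -(map_submx f) map_mx1; apply: submx_trans sC _.
apply/sumsmx_subP => i _.
have /mxOverP/(_ 0 i)/complex_realP[r dr] := hermitian_spectral_diag_real hermC.
rewrite -/d in dr; rewrite dr -/f -(map_eigenspace f) map_submx.
have [-> | nz] := eqVneq (eigenspace A r) 0; first exact: sub0mx.
have /(nthP 0)[k ks <-] := eigA _ nz.
by rewrite (big_nth 0) big_mkord (sumsmx_sup (Ordinal ks)).
Qed.


Lemma rank_eigenspace_eq_of_ge (F : fieldType) n (A : 'M[F]_n)
    (s : seq (F * nat)) :
  uniq (unzip1 s) -> (\sum_(am <- s) am.2)%N = n ->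
  (forall am, am \in s -> (am.2 <= \rank (eigenspace A am.1))%N) ->
  forall am, am \in s -> \rank (eigenspace A am.1) = am.2.
Proof.
move=> us sn ges am ams; have le1 := sum_rank_eigenspace_le A us.
apply/eqP; rewrite eqn_leq ges // andbT leqNgt; apply/negP => lt.
suff : (\sum_(am <- s) am.2 < \sum_(a <- unzip1 s) \rank (eigenspace A a))%N.
  by rewrite sn ltnNge le1.
rewrite big_map (bigD1_seq am) ?(map_uniq us) //=.
rewrite [ltnRHS](bigD1_seq am) ?(map_uniq us) //=.
rewrite -addSn leq_add // big_seq_cond [leqRHS]big_seq_cond leq_sum //.
by move=> bm /andP[/ges].
Qed.

(** Since eigenspaces are independent, lower bounds adding up to [n] leave room neither for larger
    ranks nor for further eigenvalues. *)
Lemma has_spectrum_of_rank_ge (R : realType) n (A : 'M[R]_n)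
    (s : seq (R * nat)) :
  uniq (unzip1 s) -> (\sum_(am <- s) am.2)%N = n ->
  (forall am, am \in s -> (0 < am.2 <= \rank (eigenspace A am.1))%N) ->
  has_spectrum A s.
Proof.
move=> us sn ges.
have eqs : forall am, am \in s -> \rank (eigenspace A am.1) = am.2.
  by apply: rank_eigenspace_eq_of_ge => // am /ges/andP[].
split=> // [a|a m ams]; last exact: (eqs _ ams).
apply/idP/idP => [ea | /mapP[am ams ->]]; last first.
  by rewrite /eigenvalue -mxrank_eq0 -lt0n (eqs _ ams); case/andP: (ges _ ams).
apply/negPn/negP => nas.
have := @sum_rank_eigenspace_le _ _ A (a :: unzip1 s).
rewrite /= nas us => /(_ isT); rewrite big_cons big_map.
rewrite (eq_big_seq _ eqs) sn -[X in (_ <= X)%N]add0n leq_add2r leqn0.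
by rewrite mxrank_eq0; apply/negP.
Qed.

Lemma has_spectrum_sum_eigenspace (R : realType) n (A : 'M[R]_n)
    (s : seq (R * nat)) :
  A^T = A -> has_spectrum A s ->
  (1%:M <= \sum_(a <- unzip1 s) eigenspace A a)%MS.
Proof.
move=> symA [_ es _]; apply: real_symmetric_sum_eigenspace => // a.
by rewrite es.
Qed.

Lemma has_spectrum_size (R : realType) n (A : 'M[R]_n) (s : seq (R * nat)) :
  A^T = A -> has_spectrum A s -> (\sum_(am <- s) am.2)%N = n.
Proof.
move=> symA sA; have sumA := has_spectrum_sum_eigenspace symA sA.
have [us _ rs] := sA.
have -> : (\sum_(am <- s) am.2 = \sum_(a <- unzip1 s) \rank (eigenspace A a))%N.
  by rewrite big_map; apply: eq_big_seq => -[a m] /rs <-.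
apply/eqP; rewrite eqn_leq sum_rank_eigenspace_le //=.
have := mxrankS sumA; rewrite mxrank1 => /leq_trans; apply.
rewrite (big_nth 0) [leqRHS](big_nth 0) !big_mkord.
exact: mxrank_sum_leqif.
Qed.

Lemma mxtrace_sqr_spectrum (R : realType) n (A : 'M[R]_n)
    (s : seq (R * nat)) :
  A^T = A -> has_spectrum A s ->
  \tr (A *m A) = \sum_(am <- s) am.1 ^+ 2 *+ am.2.
Proof.
move=> symA sA; have sumA := has_spectrum_sum_eigenspace symA sA.
have sn := has_spectrum_size symA sA.
have [us es rs] := sA.
have /diagonalizablePeigen[P uP /diagonalizable_forLR-/(_ uP)[d]] :
    exists2 rs, uniq rs & (\sum_(r <- rs) eigenspace A r :=: 1%:M)%MS.
  by exists (unzip1 s) => //; apply/eqmxP; rewrite submx1.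
rewrite mxpoly.conjVmx // => defA.
have eigd i : d 0 i \in unzip1 s.
  rewrite -es; apply/eigenvalueP; exists (row i P).
    exact/eigenspaceP/row_eigenspace_diag.
  apply/negP => /eqP/(congr1 (fun v => (v *m invmx P) 0 i))/eqP.
  by rewrite -row_mul mulmxV // mul0mx !mxE eqxx oner_eq0.
have -> : \tr (A *m A) = \sum_i d 0 i ^+ 2.
  have -> : A *m A = invmx P *m (diag_mx d *m diag_mx d *m P).
    by rewrite {1 2}defA !mulmxA mulmxK.
  rewrite mxtrace_mulC mulmxK // mulmx_diag mxtrace_diag.
  by apply: eq_bigr => i _; rewrite !mxE expr2.
pose c a := #|[pred i | d 0 i == a]|.
have sumd (V : nmodType) (F : R -> V) :
    \sum_i F (d 0 i) = \sum_(a <- unzip1 s) F a *+ c a.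
  under [RHS]eq_bigr => a _.
    rewrite -sumr_const (eq_bigr (fun i => F (d 0 i))); last first.
      by move=> i /eqP ->.
    over.
  rewrite (exchange_big_dep predT) //=; apply: eq_bigr => i _.
  rewrite big_mkcond (bigD1_seq (d 0 i)) //= inE eqxx big1 ?addr0 // => a.
  by rewrite inE eq_sym => /negPf ->.
have sumc : (\sum_(am <- [seq (a, c a) | a <- unzip1 s]) am.2)%N = n.
  have := sumd nat (fun=> 1%N); rewrite sumr_const card_ord natn => ->.
  by rewrite big_map; apply: eq_bigr => a _; rewrite natn.
(* The rows of [P] at the positions of [a] on the diagonal are independent eigenvectors; as the
   counts [c a] add up to [n], they are the multiplicities. *)
have gec a : (c a <= \rank (eigenspace A a))%N.
  pose f (i : 'I_(c a)) := enum_val i : 'I_n.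
  have : (rowsub f P <= eigenspace A a)%MS.
    apply/row_subP => i; rewrite row_rowsub.
    have /eqP <- : d 0 (f i) == a by have := enum_valP i; rewrite inE.
    exact: row_eigenspace_diag.
  move/mxrankS; suff /eqP -> : row_free (rowsub f P) by [].
  apply/row_freeP; exists (colsub f (invmx P)).
  rewrite -mxsub_mul mulmxV //; apply/matrixP=> i j; rewrite !mxE.
  by rewrite (inj_eq enum_val_inj).
rewrite (sumd _ (fun a => a ^+ 2)) big_map.
apply: eq_big_seq => -[a m] ams /=; congr (_ *+ _).
rewrite -(rs _ _ ams); symmetry.
apply: (@rank_eigenspace_eq_of_ge _ _ A [seq (a, c a) | a <- unzip1 s]
  _ _ _ (a, c a)) => //.
- by rewrite /unzip1 -map_comp map_id_in.
- by move=> am /mapP[b _ ->]; apply: gec.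
- by apply/mapP; exists a => //; apply/mapP; exists (a, m).
Qed.

(** * Linear combinations with the all-ones matrix *)

Section AffineJ.
Variables (F : fieldType) (n : nat).
Implicit Types (B W : 'M[F]_n) (a p q r t : F).

Let u : 'rV[F]_n := const_mx 1.

Lemma all_ones_mxE : const_mx 1 = u^T *m u :> 'M[F]_n.
Proof. by apply/matrixP=> i j; rewrite !mxE big_ord1 !mxE mulr1. Qed.

(** Both S = J - I - 2A and A = (J - I - S)/2 have this form, so the same lemmas serve both
    directions. *)
Definition affineJ p q r B : 'M[F]_n := p *: const_mx 1 + q%:M + r *: B.

Lemma mulmx_affineJ m (W : 'M_(m, n)) p q r B a :
  W *m u^T = 0 -> W *m B = a *: W -> W *m affineJ p q r B = (q + r * a) *: W.
Proof.
move=> Wu WB; rewrite /affineJ !mulmxDr -!scalemxAr all_ones_mxE mulmxA Wu.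
by rewrite mul0mx scaler0 add0r WB mul_mx_scalar scalerA scalerDl.
Qed.

Lemma all_ones_affineJ p q r B t :
  u *m B = t *: u -> u *m affineJ p q r B = (p * n%:R + q + r * t) *: u.
Proof.
move=> uB; have uu : u *m u^T = n%:R%:M.
  apply/matrixP=> i j; rewrite !ord1 !mxE eqxx mulr1n.
  under eq_bigr do rewrite !mxE mulr1.
  by rewrite sumr_const card_ord.
rewrite /affineJ !mulmxDr -!scalemxAr all_ones_mxE mulmxA uu.
by rewrite mul_scalar_mx uB mul_mx_scalar !scalerA -!scalerDl.
Qed.

Lemma eigenspace_orthogonal m (W : 'M_(m, n)) k (V : 'M_(k, n)) B a t :
  B^T = B -> W *m B = a *: W -> V *m B = t *: V -> a != t -> W *m V^T = 0.
Proof.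
move=> symB WB VB at_neq; have BV : B *m V^T = t *: V^T.
  by rewrite -{1}symB -trmx_mul VB linearZ.
have : (a - t) *: (W *m V^T) = 0.
  by rewrite scalerBl scalemxAl -WB -mulmxA BV -scalemxAr subrr.
by move/eqP; rewrite scaler_eq0 subr_eq0 (negPf at_neq) => /eqP.
Qed.

Lemma eigenspace_affineJ p q r B a t :
  B^T = B -> u *m B = t *: u -> a != t ->
  (eigenspace B a <= eigenspace (affineJ p q r B) (q + r * a))%MS.
Proof.
move=> symB uB at_neq; apply/eigenspaceP/mulmx_affineJ.
  by apply: eigenspace_orthogonal uB at_neq => //; apply/eigenspaceP.
exact/eigenspaceP.
Qed.

(** Eigenvectors orthogonal to the all-ones vector remain eigenvectors, and this orthogonality costs
    at most one dimension. *)
Lemma rank_eigenspace_affineJ p q r B t :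
  (\rank (eigenspace B t) <=
    (\rank (eigenspace (affineJ p q r B) (q + r * t))).+1)%N.
Proof.
pose K := (eigenspace B t :&: kermx u^T)%MS.
have KJ : (K <= eigenspace (affineJ p q r B) (q + r * t))%MS.
  apply/eigenspaceP/mulmx_affineJ; first exact/sub_kermxP/capmxSr.
  exact/eigenspaceP/capmxSl.
have := mxrank_sum_cap (eigenspace B t) (kermx u^T).
have := mxrankS KJ; rewrite -/K mxrank_ker mxrank_tr.
have := rank_leq_row u; have := rank_leq_col (eigenspace B t + kermx u^T)%MS.
have := rank_leq_col u.
by lia.
Qed.

Lemma rank_all_ones_eigenspace B t :
  (0 < n)%N -> u *m B = t *: u -> (0 < \rank (eigenspace B t))%N.
Proof.
move=> n0 /eigenspaceP/mxrankS; apply: leq_trans.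
rewrite lt0n mxrank_eq0; apply/eqP => /rowP/(_ (Ordinal n0))/eqP.
by rewrite !mxE oner_eq0.
Qed.

(** When the new eigenvalue of the all-ones vector collides with the image of [a], the eigenspace
    gains that vector, which was outside because [a != t]. *)
Lemma rank_eigenspace_affineJ_adds p q r B a t :
  (0 < n)%N -> B^T = B -> u *m B = t *: u -> a != t ->
  p * n%:R + q + r * t = q + r * a ->
  (\rank (eigenspace B a) <
     \rank (eigenspace (affineJ p q r B) (q + r * a)))%N.
Proof.
move=> n0 symB uB at_neq eq_ev; set C := affineJ p q r B.
have uC : (u <= eigenspace C (q + r * a))%MS.
  by apply/eigenspaceP; rewrite -eq_ev (all_ones_affineJ p q r uB).
have sub := eigenspace_affineJ p q r symB uB at_neq.
apply: rank_ltmx; rewrite ltmxE sub; apply: contraNN at_neq => le.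
have := submx_trans uC le => /eigenspaceP; rewrite uB => /rowP/(_ (Ordinal n0)).
by rewrite !mxE !mulr1 => ->.
Qed.

End AffineJ.

(** Splitting [v] into eigenvectors x_i with eigenvalues theta_i gives a vanishing sum of
    nonnegative terms (k - theta_i) |x_i|^2, so only components with eigenvalue [k] survive. *)
Lemma rayleigh_eq (R : realType) n (A : 'M[R]_n) (rs : seq R) k (v : 'rV_n) :
  A^T = A -> (1%:M <= \sum_(a <- rs) eigenspace A a)%MS -> uniq rs ->
  (forall a, a \in rs -> a <= k) ->
  v *m A *m v^T = k *: (v *m v^T) -> v *m A = k *: v.
Proof.
move=> symA sumA urs lek; rewrite (big_nth 0) big_mkord in sumA.
have /sub_sumsmxP[w defv] := submx_trans (submx1 v) sumA.
pose x i := w i *m eigenspace A rs`_i.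
have xA i : x i *m A = rs`_i *: x i by apply/eigenspaceP; rewrite submxMl.
have orth (i j : 'I_(size rs)) : i != j -> x i *m (x j)^T = 0.
  move=> ij; apply: (eigenspace_orthogonal symA (xA i) (xA j)).
  by rewrite nth_uniq.
have xx i : 0 <= (x i *m (x i)^T) 0 0.
  by rewrite mxE sumr_ge0 // => j _; rewrite !mxE -expr2 sqr_ge0.
have qf (c : 'I_(size rs) -> R) :
    ((\sum_i c i *: x i) *m v^T) 0 0 = \sum_i c i * (x i *m (x i)^T) 0 0.
  rewrite mulmx_suml summxE; apply: eq_bigr => i _.
  rewrite -scalemxAl mxE; congr (_ * _).
  rewrite defv linear_sum /= mulmx_sumr summxE (bigD1 i) //= big1 ?addr0 //.
  by move=> j ji; rewrite orth ?mxE // eq_sym.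
have vA : v *m A = \sum_(i < size rs) rs`_i *: x i.
  by rewrite {1}defv mulmx_suml; apply: eq_bigr => i _; apply: xA.
have kv : k *: v = \sum_(i < size rs) k *: x i by rewrite {1}defv scaler_sumr.
rewrite scalemxAl vA kv => /matrixP/(_ 0 0); rewrite !qf => /esym/eqP.
rewrite -subr_eq0 -sumrB psumr_eq0 => [/allP z|i _]; last first.
  by rewrite -mulrBl mulr_ge0 // subr_ge0 lek // mem_nth.
apply: eq_bigr => i _; have := z i (mem_index_enum _).
rewrite /= -mulrBl mulf_eq0 subr_eq0 => /orP[/eqP -> //|].
rewrite mxE psumr_eq0 => [/allP xi0|j _]; last by rewrite !mxE -expr2 sqr_ge0.
have -> : x i = 0; last by rewrite !scaler0.
apply/rowP=> j; have := xi0 j (mem_index_enum _).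
by rewrite !mxE -expr2 sqrf_eq0 => /eqP.
Qed.

(** * Seidel matrices and graphs *)

Lemma has_spectrum_perm (R : realType) n (A : 'M[R]_n) s s' :
  perm_eq s s' -> has_spectrum A s -> has_spectrum A s'.
Proof.
move=> ss' [us es rs]; have mapss' := perm_map fst ss'.
split=> [|a|a m]; rewrite -?(perm_uniq mapss') -?(perm_mem mapss') //.
by rewrite -(perm_mem ss'); apply: rs.
Qed.

Lemma has_spectrum_pos (R : realType) n (A : 'M[R]_n) s am :
  has_spectrum A s -> am \in s -> (0 < am.2)%N.
Proof.
move=> [_ es rs] ams; have := es am.1; rewrite map_f // /eigenvalue.
by rewrite -mxrank_eq0 -lt0n; case: am ams => a m /rs ->.
Qed.

Lemma adjacency_matrix_sym (R : realType) (G : sgraph) :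
  (adjacency_matrix R G)^T = adjacency_matrix R G.
Proof. by apply/matrixP=> i j; rewrite !mxE edge_sym. Qed.

Lemma regular_of_spectrum (R : realType) (G : sgraph) (s : seq (R * nat)) k :
  has_spectrum (adjacency_matrix R G) s ->
  (forall a, a \in unzip1 s -> a <= k) ->
  \sum_(am <- s) am.1 ^+ 2 *+ am.2 = k * #|G|%:R ->
  const_mx 1 *m adjacency_matrix R G = k *: const_mx 1 :> 'rV_#|G|.
Proof.
set A := adjacency_matrix R G => sA lek sumsq.
have symA : A^T = A by apply: adjacency_matrix_sym.
have [us _ _] := sA.
apply: (rayleigh_eq symA (has_spectrum_sum_eigenspace symA sA) us lek).
apply/matrixP=> i j; rewrite !ord1 {i j} [RHS]mxE [in RHS]mxE [LHS]mxE.
rewrite (eq_bigr (fun j => \sum_i A i j)); last first.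
  move=> j _; rewrite [_^T _ _]mxE [const_mx _ _ _]mxE mulr1 mxE.
  by apply: eq_bigr => i _; rewrite [const_mx _ _ _]mxE mul1r.
rewrite [in RHS](eq_bigr (fun j => 1)) => [|j _]; last by rewrite !mxE mulr1.
rewrite sumr_const card_ord -sumsq -(mxtrace_sqr_spectrum symA sA).
(* Entries 0 and 1 equal their squares, so each column sum is a diagonal entry of [A *m A]. *)
apply: eq_bigr => j _; rewrite mxE; apply: eq_bigr => i _.
by rewrite -{2}symA !mxE -natrM mulnb andbb.
Qed.

Definition seidel_of (R : realType) (G : sgraph) : 'M[R]_#|G| :=
  affineJ 1 (-1) (-2) (adjacency_matrix R G).

Lemma affineJ_sym (F : fieldType) n p q r (B : 'M[F]_n) :
  B^T = B -> (affineJ p q r B)^T = affineJ p q r B.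
Proof.
move=> symB; rewrite /affineJ !linearD !linearZ /= trmx_const tr_scalar_mx.
by rewrite symB.
Qed.

Lemma seidel_ofP (R : realType) (G : sgraph) : seidel_matrix (seidel_of R G).
Proof.
have ent i j : seidel_of R G i j =
    if i == j then 0 else if edge (enum_val i) (enum_val j) then -1 else 1.
  rewrite !mxE; case: eqVneq => [->|_]; rewrite ?edge_irrefl /=; first lra.
  by case: edge => /=; lra.
split=> [|i j|i|i j ij].
- exact/affineJ_sym/adjacency_matrix_sym.
- by rewrite ent; case: ifP => _; [|case: ifP => _]; rewrite !inE eqxx ?orbT.
- by rewrite ent eqxx.
- by rewrite ent (negPf ij); case: ifP; rewrite ?oppr_eq0 oner_eq0.
Qed.

(** The condition n = 2(k - c) says that n - 1 - 2k = -1 - 2c: the all-ones vector joins the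
    eigenspace coming from [c], whence [m.+1]. *)
Lemma seidel_spectrum_of_graph (R : realType) (G : sgraph) k c m
    (s : seq (R * nat)) :
  has_spectrum (adjacency_matrix R G) [:: (k, 1%N), (c, m) & s] ->
  (forall a, a \in c :: unzip1 s -> a < k) ->
  \sum_(am <- (c, m) :: s) am.1 ^+ 2 *+ am.2 + k ^+ 2 = k * #|G|%:R ->
  #|G|%:R = 2 * (k - c) ->
  exists S : 'M[R]_#|G|, seidel_matrix S /\
    has_spectrum S
      ((-1 - 2 * c, m.+1) :: [seq (-1 - 2 * am.1, am.2) | am <- s]).
Proof.
set A := adjacency_matrix R G => sA ltk sumsq n2.
exists (seidel_of R G); split; first exact: seidel_ofP.
have symA : A^T = A by apply: adjacency_matrix_sym.
have uA : const_mx 1 *m A = k *: const_mx 1 :> 'rV_#|G|.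
  apply: (regular_of_spectrum sA) => [a|].
    by rewrite /= in_cons => /predU1P[-> //|/ltk/ltW].
  by rewrite big_cons /= mulr1n addrC.
have n0 : (0 < #|G|)%N.
  by rewrite -(ltr_nat R) n2 mulr_gt0 // subr_gt0 ltk // mem_head.
have sn := has_spectrum_size symA sA.
have [us _ rs] := sA.
have evE a : -1 - 2 * a = -1 + -2 * a :> R by rewrite mulNr.
apply: has_spectrum_of_rank_ge.
- have -> : unzip1 ((-1 - 2 * c, m.+1) :: [seq (-1 - 2 * am.1, am.2) | am <- s])
    = [seq -1 - 2 * a | a <- c :: unzip1 s].
    by rewrite /unzip1 /= -!map_comp.
  rewrite map_inj_uniq => [|a b ab]; first by case/andP: us.
  by lra.
- by rewrite big_cons big_map -[RHS]sn !big_cons /=; lia.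
move=> am; rewrite inE => /predU1P[-> /=|/mapP[{}am ams -> /=]].
  rewrite evE; rewrite -[X in (X < _)%N](rs c m) ?inE ?eqxx ?orbT //.
  apply: (@rank_eigenspace_affineJ_adds _ _ 1 (-1) (-2) A c k) => //.
    by rewrite lt_eqF // ltk // mem_head.
  by rewrite n2; ring.
have ams' : am \in [:: (k, 1%N), (c, m) & s] by rewrite !inE ams !orbT.
rewrite (has_spectrum_pos sA) //= evE -[X in (X <= _)%N](rs am.1 am.2).
  apply: mxrankS; apply: (eigenspace_affineJ 1 (-1) (-2) symA uA).
  by rewrite lt_eqF // ltk // inE map_f ?orbT.
by rewrite -surjective_pairing.
Qed.

Lemma seidel_entry (R : realType) n (S : 'M[R]_n) i j :
  seidel_matrix S -> i != j -> S i j = 1 \/ S i j = -1.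
Proof.
move=> [_ ent _ nz] ij; have := nz _ _ ij; have := ent i j.
by rewrite !inE => /or3P[]/eqP ->; rewrite ?eqxx; auto.
Qed.

(** * Switching with respect to a vector of signs *)

Section Switching.
Variables (R : realType) (n : nat) (S : 'M[R]_n) (x : 'rV[R]_n).
Hypothesis x1 : forall i, x 0 i ^+ 2 = 1.

Definition switching : 'M[R]_n := diag_mx x *m S *m diag_mx x.

Lemma switching_diagK : diag_mx x *m diag_mx x = 1%:M.
Proof.
rewrite mulmx_diag -diag_const_mx; congr diag_mx.
by apply/rowP=> i; rewrite !mxE -expr2 x1.
Qed.

Lemma switchingE i j : switching i j = x 0 i * S i j * x 0 j.
Proof. by rewrite /switching mul_mx_diag mxE mul_diag_mx mxE. Qed.

Lemma seidel_switching : seidel_matrix S -> seidel_matrix switching.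
Proof.
move=> seS; have [symS ent d0 nz] := seS.
have xpm i : x 0 i = 1 \/ x 0 i = -1.
  by have /eqP := x1 i; rewrite sqrf_eq1 => /orP[]/eqP; auto.
split=> [|i j|i|i j ij].
- by rewrite /switching !trmx_mul tr_diag_mx symS mulmxA.
- rewrite switchingE; have [->|ij] := eqVneq i j.
    by rewrite d0 mulr0 mul0r inE eqxx.
  by case: (xpm i) => ->; case: (xpm j) => ->;
    case: (seidel_entry seS ij) => ->;
    rewrite ?mulrN ?mulNr ?mulr1 ?opprK !inE eqxx ?orbT.
- by rewrite switchingE d0 mulr0 mul0r.
- rewrite switchingE !mulf_neq0 ?nz //.
    by case: (xpm i) => ->; rewrite ?oppr_eq0 oner_eq0.
  by case: (xpm j) => ->; rewrite ?oppr_eq0 oner_eq0.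
Qed.

Lemma all_ones_switching t :
  x *m S = t *: x -> const_mx 1 *m switching = t *: const_mx 1 :> 'rV_n.
Proof.
move=> xS; have ux : const_mx 1 *m diag_mx x = x.
  by apply/rowP=> i; rewrite mul_mx_diag !mxE mul1r.
have xu : x *m diag_mx x = const_mx 1.
  by rewrite -{1}ux -mulmxA switching_diagK mulmx1.
by rewrite /switching !mulmxA ux xS -scalemxAl xu.
Qed.

Lemma rank_eigenspace_switching a :
  (\rank (eigenspace S a) <= \rank (eigenspace switching a))%N.
Proof.
have uD : diag_mx x \in unitmx by case/mulmx1_unit: switching_diagK.
rewrite -(mxrankMfree _ (B := diag_mx x)) ?row_free_unit //.
apply/mxrankS/eigenspaceP; rewrite /switching !mulmxA.
rewrite -[_ *m diag_mx x *m diag_mx x]mulmxA switching_diagK mulmx1.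
by have /eigenspaceP -> := submx_refl (eigenspace S a); rewrite scalemxAl.
Qed.

End Switching.

(** Adjacency is the entry -1. The conclusion goes through spectra because [#|G|] and [#|T|] are not
    convertible once [G] is bound by the quantifier. *)
Lemma graph_of_seidel (R : realType) (T : finType) (S : 'M[R]_#|T|) :
  seidel_matrix S ->
  exists G : sgraph, forall s,
    has_spectrum (affineJ 2^-1 (- 2^-1) (- 2^-1) S) s ->
    has_spectrum (adjacency_matrix R G) s.
Proof.
move=> seS; have [symS ent d0 nz] := seS.
pose e := fun v w : T => S (enum_rank v) (enum_rank w) == -1.
have esym : symmetric e by move=> v w; rewrite /e -{1}symS mxE.
have eirr : irreflexive e.
  by move=> v; rewrite /e d0 eq_sym oppr_eq0 oner_eq0.
exists (SGraph esym eirr) => s.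
suff -> : adjacency_matrix R (SGraph esym eirr) =
  affineJ 2^-1 (- 2^-1) (- 2^-1) S by [].
apply/matrixP=> i j; rewrite [LHS]mxE /= /e !enum_valK.
rewrite !mxE; have [->|ij] := eqVneq i j.
  by rewrite d0 eq_sym oppr_eq0 oner_eq0 /=; lra.
case: (seidel_entry seS ij) => ->; rewrite ?eqxx /=; last lra.
by rewrite eq_sym eqNr oner_eq0 /=; lra.
Qed.

(** Switching turns [x] into the all-ones vector, and one dimension of the [t]-eigenspace is spent
    on the valency (n - 1 - t)/2. The bound on [t - n] keeps the valency apart from the other
    eigenvalues. *)
Lemma graph_spectrum_of_seidel (R : realType) n (S : 'M[R]_n) t m
    (s : seq (R * nat)) (x : 'rV[R]_n) :
  seidel_matrix S -> has_spectrum S ((t, m.+1) :: s) -> (0 < m)%N ->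
  (forall a, a \in t :: unzip1 s -> t - n%:R < a) ->
  (forall i, x 0 i ^+ 2 = 1) -> x *m S = t *: x ->
  exists G : sgraph,
    has_spectrum (adjacency_matrix R G)
      [:: ((n%:R - 1 - t) / 2, 1%N), ((-1 - t) / 2, m)
        & [seq ((-1 - am.1) / 2, am.2) | am <- s]].
Proof.
wlog [T eqn] : n S x / exists T : finType, n = #|T|.
  by apply; exists 'I_n; rewrite card_ord.
subst n => seS sS m0 gtt x1 xS.
have seS' := seidel_switching x1 seS; have [symS' _ _ _] := seS'.
have [G GP] := graph_of_seidel seS'; exists G; apply: {G} GP.
have sn := has_spectrum_size (let: And4 p _ _ _ := seS in p) sS.
have uS' := all_ones_switching x1 xS.
have [us _ rs] := sS.
have n0 : (0 < #|T|)%N by rewrite -sn big_cons /=.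
have evE (a : R) : (-1 - a) / 2 = - 2^-1 + - 2^-1 * a by lra.
apply: has_spectrum_of_rank_ge.
(* The valency is the image of [t - n] under the injective map a -> (-1 - a)/2. *)
- set r := (r in uniq r).
  have -> : r = [seq (-1 - a) / 2 | a <- t - #|T|%:R :: t :: unzip1 s].
    by rewrite /r /unzip1 /= -!map_comp; congr (_ :: _); lra.
  rewrite map_inj_uniq => [|a b ab]; last by lra.
  rewrite cons_uniq us andbT; apply/negP => /gtt.
  by rewrite ltxx.
- by rewrite -[RHS]sn !big_cons big_map /=; lia.
move=> am; rewrite !inE => /or3P[/eqP->|/eqP->|/mapP[{}am ams ->]] /=.
- apply: rank_all_ones_eigenspace => //.
  by rewrite (all_ones_affineJ _ _ _ uS'); congr (_ *: _); lra.
- rewrite m0 /= evE -ltnS.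
  apply: leq_trans (rank_eigenspace_affineJ 2^-1 (- 2^-1) (- 2^-1) _ t).
  by rewrite -[X in (X <= _)%N](rs t) ?mem_head // rank_eigenspace_switching.
have ams' : am \in (t, m.+1) :: s by rewrite inE ams orbT.
rewrite (has_spectrum_pos sS) //= evE.
rewrite -[X in (X <= _)%N](rs am.1) -?surjective_pairing //.
apply: (leq_trans (rank_eigenspace_switching S x1 _)).
apply: mxrankS; apply: (eigenspace_affineJ _ _ _ symS' uS').
apply: contraTneq us => <-; rewrite /= map_f //.
Qed.

(** * Flat vectors in integral tight frames *)

Section TightGram.
Variables (n : nat) (c d : int) (g : 'I_n -> 'I_n -> int) (col : 'I_n -> bool).
Hypotheses (c_gt0 : 0 < c) (g_sym : forall i j, g i j = g j i)
  (g_diag : forall i, g i i = d)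
  (g_tight : forall i j, \sum_k g i k * g j k = c * g i j)
  (g_parity : forall i j, exists z,
     g i j = d + 2 * z + (if col i == col j then 0 else 1)).

(** Tightness makes every row of [g] an eigenvector. Four terms cover all three cases; shorter
    combinations take zero coefficients. *)
Lemma comb_rows_eigen a0 a1 a2 a3 i0 i1 i2 i3
    (y := fun k => a0 * g i0 k + a1 * g i1 k + a2 * g i2 k + a3 * g i3 k) i :
  \sum_k g i k * y k = c * y i.
Proof.
have -> : c * y i = a0 * (c * g i i0) + a1 * (c * g i i1) + a2 * (c * g i i2)
    + a3 * (c * g i i3).
  by rewrite /y !(g_sym _ i); ring.
rewrite -!g_tight !mulr_sumr -!big_split /=.
by apply: eq_bigr => k _; rewrite /y; ring.
Qed.

(** This is the tight frame identity for x = a0 v_i0 + ... + a3 v_i3, with y k = <x, v_k>. *)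
Lemma sum_sqr_rows a0 a1 a2 a3 i0 i1 i2 i3
    (y := fun k => a0 * g i0 k + a1 * g i1 k + a2 * g i2 k + a3 * g i3 k) :
  \sum_k y k ^+ 2 = c * (a0 * y i0 + a1 * y i1 + a2 * y i2 + a3 * y i3).
Proof.
have -> : c * (a0 * y i0 + a1 * y i1 + a2 * y i2 + a3 * y i3) =
    a0 * (c * y i0) + a1 * (c * y i1) + a2 * (c * y i2) + a3 * (c * y i3).
  by ring.
rewrite -!comb_rows_eigen !mulr_sumr -!big_split /=.
by apply: eq_bigr => k _; rewrite /y; ring.
Qed.

Lemma sum_sqr_row i : \sum_k g i k ^+ 2 = c * d.
Proof. by under eq_bigr do rewrite expr2; rewrite g_tight g_diag. Qed.

(** Equality in Cauchy-Schwarz: g_ij v_i - d v_j has squared norm d (d^2 - g_ij^2) = 0, so by the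
    frame identity it is orthogonal to every v_k. *)
Lemma parallel i j k : g i j ^+ 2 = d ^+ 2 -> d * g j k = g i j * g i k.
Proof.
move=> gij; have := sum_sqr_rows (g i j) (- d) 0 0 i j i i.
rewrite /= !g_diag (g_sym j i) => sum0.
have {}sum0 : \sum_k (d * g j k - g i j * g i k) ^+ 2 = 0.
  transitivity (c * (d * (d ^+ 2 - g i j ^+ 2))); last first.
    by rewrite gij subrr !mulr0.
  apply: etrans (etrans sum0 _); last by ring.
  by apply: eq_bigr => l _; ring.
have /allP/(_ k (mem_index_enum _)) :
    all (fun k => (d * g j k - g i j * g i k) ^+ 2 == 0) (index_enum 'I_n).
  have := psumr_eq0 (index_enum 'I_n) (P := xpredT)
    (F := fun k => (d * g j k - g i j * g i k) ^+ 2).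
  by rewrite sum0 eqxx => <- // l _; apply: sqr_ge0.
by rewrite sqrf_eq0 subr_eq0 => /eqP.
Qed.

(** By the frame identity and c > 0, the squared norms 2d + 2g_ij and 2d - 2g_ij of v_i + v_j and
    v_i - v_j are nonnegative. *)
Lemma gram_bound i j : - d <= g i j <= d.
Proof.
have := sum_sqr_rows 1 1 0 0 i j i i; have := sum_sqr_rows 1 (-1) 0 0 i j i i.
rewrite /= !g_diag (g_sym j i).
set s1 := \sum_k _; set s2 := \sum_k _.
have s1_ge0 : 0 <= s1 by apply: sumr_ge0 => k _; apply: sqr_ge0.
have s2_ge0 : 0 <= s2 by apply: sumr_ge0 => k _; apply: sqr_ge0.
by move=> e1 e2; apply/andP; split; nia.
Qed.

Definition same_class i k : int := if col i == col k then 1 else 0.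
Definition same_line i k : int := if g i k ^+ 2 == d ^+ 2 then 1 else 0.
Definition class_size i := \sum_k same_class i k.
Definition line_size i := \sum_k same_line i k.

Lemma class_size_other i j : col i != col j -> class_size i + class_size j = n.
Proof.
move=> ij; rewrite /class_size -big_split /=.
rewrite (eq_bigr (fun _ => 1)) => [|k _]; last first.
  by rewrite /same_class; move: ij; case: (col i) (col j) (col k) => [] [] [].
by rewrite sumr_const card_ord; lia.
Qed.

Lemma class_size_le i : class_size i <= n.
Proof.
have -> : n%:Z = \sum_(k < n) 1 by rewrite sumr_const card_ord; lia.
by apply: ler_sum => k _; rewrite /same_class; case: ifP.
Qed.

Lemma class_size_gt0 i : 0 < class_size i.
Proof.
rewrite /class_size (bigD1 i) //= {1}/same_class eqxx ltr_wpDr //.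
by apply: sumr_ge0 => k _; rewrite /same_class; case: ifP.
Qed.


(** Dividing [y] by [tau] will give the vector of signs used for switching; allowing any common
    absolute value keeps the argument in the integers. *)
Definition flat_eigenvector := exists y : 'I_n -> int, exists tau,
  [/\ tau != 0, forall k, y k ^+ 2 = tau ^+ 2
    & forall i, \sum_k g i k * y k = c * y i].

Lemma comb_rows_flat a0 a1 a2 a3 i0 i1 i2 i3 tau : tau != 0 ->
  (forall k, (a0 * g i0 k + a1 * g i1 k + a2 * g i2 k + a3 * g i3 k) ^+ 2
     = tau ^+ 2) ->
  flat_eigenvector.
Proof.
move=> tau0 flat.
exists (fun k => a0 * g i0 k + a1 * g i1 k + a2 * g i2 k + a3 * g i3 k), tau.
by split=> // i; apply: comb_rows_eigen.
Qed.

Lemma sum_ge_eq (I : finType) (F G : I -> int) :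
  (forall i, F i <= G i) -> \sum_i F i = \sum_i G i -> forall i, F i = G i.
Proof.
move=> leFG sumFG i; apply/eqP; rewrite eq_sym -subr_eq0.
have : \sum_i (G i - F i) == 0 by rewrite sumrB sumFG subrr.
rewrite psumr_eq0 => [/allP/(_ i (mem_index_enum _)) //|k _].
by rewrite subr_ge0.
Qed.

Lemma sum_lt_exists (I : finType) (F G : I -> int) :
  \sum_i F i < \sum_i G i -> exists i, F i < G i.
Proof.
move=> ltFG; case: (pickP (fun i => F i < G i)) => [i|none]; first by exists i.
suff : \sum_i G i <= \sum_i F i by rewrite leNgt ltFG.
by apply: ler_sum => i _; have := none i; rewrite ltNge => /negPn.
Qed.

Lemma parallel_trans i j k : d != 0 ->
  g i k ^+ 2 = d ^+ 2 -> g j k ^+ 2 = d ^+ 2 -> g i j ^+ 2 = d ^+ 2.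
Proof.
move=> d0 ik jk; have /(congr1 (fun a => a ^+ 2)) := parallel j ik.
rewrite /= !exprMn ik (g_sym k) jk => /mulfI <- //.
by rewrite sqrf_eq0.
Qed.

Lemma class_size_eq i j : col i = col j -> class_size i = class_size j.
Proof.
by move=> ij; apply: eq_bigr => k _; rewrite /same_class ij.
Qed.

Lemma class_size_full i : (forall k, col i = col k) -> class_size i = n.
Proof.
move=> one; rewrite /class_size (eq_bigr (fun=> 1)) => [|k _].
  by rewrite sumr_const card_ord; lia.
by rewrite /same_class (one k) eqxx.
Qed.

(** * Sixty vectors of squared norm 2 *)

Section Case60.
Hypotheses (c40 : c = 40) (d2 : d = 2) (n60 : n = 60%N).

Lemma gram_values_60 i k :
  if col i == col k then g i k = 0 \/ g i k ^+ 2 = 4 else g i k ^+ 2 = 1.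
Proof.
have [z] := g_parity i k; have := gram_bound i k; rewrite d2.
move: (g i k) => a; case: ifP => _ bd az.
  suff : a = 0 \/ a = 2 \/ a = -2 by case=> [|[]] ->; auto.
  by lia.
suff : a = 1 \/ a = -1 by case=> ->.
by lia.
Qed.

(** The squares in a row add up to 80: each is 4 on the line of v_i, 0 in the rest of its class and
    1 in the other class. *)
Lemma line_size_60 i : 4 * line_size i = 20 + class_size i.
Proof.
have := sum_sqr_row i; rewrite c40 d2.
rewrite (eq_bigr (fun k => 4 * same_line i k + (1 - same_class i k))).
  rewrite big_split /= sumrB -mulr_sumr -/(line_size i) -/(class_size i).
  by rewrite sumr_const card_ord n60; lia.
move=> k _; have := gram_values_60 i k; rewrite /same_line /same_class d2.
by case: ifP => _; [case|] => ->.
Qed.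

(** Two lines hold (20 + size)/2 vectors, which do not exhaust a class of size greater than 20. *)
Lemma orthogonal_triple_60 i : 20 < class_size i -> exists j k,
  [/\ col i = col j, col i = col k, g i j = 0, g i k = 0 & g j k = 0].
Proof.
move=> big_i; have := line_size_60 i => line_i.
have nonline a b : same_line a b < same_class a b -> col a = col b /\ g a b = 0.
  have := gram_values_60 a b; rewrite /same_line /same_class d2.
  by case: eqP => [->|_]; [case=> ->|move=> ->].
have [|j /nonline[ij gij]] := @sum_lt_exists _ (same_line i) (same_class i).
  by move: (class_size_le i); rewrite -/(line_size i) -/(class_size i); lia.
have := line_size_60 j; rewrite -(class_size_eq ij) => line_j.
have [|k ltk] :=
  @sum_lt_exists _ (fun k => same_line i k + same_line j k) (same_class i).
  by rewrite big_split /= -/(line_size i) -/(line_size j) -/(class_size i); lia.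
exists j, k; move: (gram_values_60 i k) (gram_values_60 j k) ltk.
rewrite /same_line /same_class d2 -ij.
case: eqP => [<-|_]; last by move=> -> ->.
by move=> [->|->] [->|->].
Qed.

(** Three orthogonal lines in one class are disjoint, so 3(20 + size)/4 <= size, which forces size
    >= 60. *)
Lemma class_size_60 i : class_size i <= 20 \/ class_size i = 60.
Proof.
have [|big_i] := lerP (class_size i) 20; [by left | right].
have [j [k [ij ik gij gik gjk]]] := orthogonal_triple_60 big_i.
have := class_size_le i; rewrite n60.
have := line_size_60 i; have := line_size_60 j; have := line_size_60 k.
rewrite -(class_size_eq ij) -(class_size_eq ik).
suff : line_size i + line_size j + line_size k <= class_size i by lia.
rewrite /line_size -!big_split /=; apply: ler_sum => l _.
have nz : d != 0 by rewrite d2.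
have := @parallel_trans i j l nz; have := @parallel_trans i k l nz.
have := @parallel_trans j k l nz; rewrite gij gik gjk d2.
move: (gram_values_60 i l) (gram_values_60 j l) (gram_values_60 k l).
rewrite /same_line /same_class d2 -ij -ik; case: ifP => _; last first.
  by move=> -> -> ->.
by move=> [->|->] [->|->] [->|->] // H1 H2 H3;
  first [have := H1 erefl erefl | have := H2 erefl erefl
       | have := H3 erefl erefl].
Qed.

Lemma flat_eigenvector_60 : flat_eigenvector.
Proof.
have n0 : (0 < n)%N by rewrite n60.
pose i := Ordinal n0.
have one_class k : col i = col k.
  apply/eqP/negPn/negP => /class_size_other.
  have := class_size_gt0 i; have := class_size_gt0 k; rewrite n60.
  by case: (class_size_60 i); case: (class_size_60 k); lia.
have [|j [k [ij ik gij gik gjk]]] := orthogonal_triple_60 (i := i).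
  by rewrite class_size_full // n60.
apply: (@comb_rows_flat 1 1 1 0 i j k i 2) => // l.
pose y l := 1 * g i l + 1 * g j l + 1 * g k l + 0 * g i l.
(* No v_l lies on two of the lines, so its square is at most 4; the total is 40 * 6 = 4 * 60, as x
   has squared norm 6. *)
apply: (@sum_ge_eq _ (fun l => y l ^+ 2) (fun => 4)) => [{}l|]; last first.
  rewrite /y sum_sqr_rows !g_diag !(g_sym _ i) (g_sym k j) gij gik gjk c40 d2.
  by rewrite sumr_const card_ord n60.
have nz : d != 0 by rewrite d2.
have := @parallel_trans i j l nz; have := @parallel_trans i k l nz.
have := @parallel_trans j k l nz; rewrite gij gik gjk d2 /y.
move: (gram_values_60 i l) (gram_values_60 j l) (gram_values_60 k l).
rewrite -!one_class eqxx.
by move=> [->|h1] [->|h2] [->|h3] // H1 H2 H3; rewrite ?h1 ?h2 ?h3;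
  first [have := H1 h2 h3 | have := H2 h1 h3 | have := H3 h1 h2
    | rewrite ?(mul1r, mul0r, add0r, addr0) ?h1 ?h2 ?h3].
Qed.

End Case60.

(** * Seventy-two vectors of squared norm 3 *)

Section Case72.
Hypotheses (c72 : c = 72) (d3 : d = 3) (n72 : n = 72%N).

(** If classes consisted of parallel vectors, the total 72 * 3 = 216 of the squares in a row would
    bound each class by 24, and at most two classes could not cover 72 indices. *)
Lemma same_class_nonparallel_72 :
  exists i, exists2 j, col i = col j & g i j ^+ 2 != 9.
Proof.
case: (pickP (fun ij : 'I_n * 'I_n =>
    (col ij.1 == col ij.2) && (g ij.1 ij.2 ^+ 2 != 9))) => [[i j]|none].
  by move=> /andP[/eqP]; exists i, j.
have size_le i : 9 * class_size i <= 216.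
  have <- : \sum_k g i k ^+ 2 = 216 by rewrite sum_sqr_row c72 d3.
  rewrite mulr_sumr; apply: ler_sum => k _; have := none (i, k).
  rewrite /same_class /=; case: ifP => _ /=; last by rewrite mulr0 sqr_ge0.
  by move/negbT; rewrite negbK => /eqP ->.
have n0 : (0 < n)%N by rewrite n72.
pose i := Ordinal n0; have := size_le i.
case: (pickP (fun j => col i != col j)) => [j /class_size_other|same].
  by have := size_le j; lia.
rewrite class_size_full => [|k]; first by lia.
by have /negbT := same k; rewrite negbK => /eqP.
Qed.

Lemma flat_eigenvector_72 : flat_eigenvector.
Proof.
have [i [j ij gij9]] := same_class_nonparallel_72.
have [s [s1 gij]] : exists s, (s = 1 \/ s = -1) /\ g i j = s.
  exists (g i j); split=> //; have := gram_bound i j.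
  have [z] := g_parity i j; rewrite ij eqxx d3 => gz.
  by nia.
pose y k := 1 * g i k + (- s) * g j k + 0 * g i k + 0 * g i k.
(* x = v_i - s v_j has squared norm 3 + 3 - 2 = 4, so the mean of the squares is 4. *)
have sumy : \sum_k y k ^+ 2 = 288.
  rewrite /y sum_sqr_rows !g_diag (g_sym j i) gij c72 d3.
  by case: s1 => ->; lia.
have y_le k : y k ^+ 2 <= 4.
  (* This comes from |x - e v_k|^2 = 7 - 2 e y_k >= 0. As i and j share a class, y_k is even, which
     sharpens 3 to 2. *)
  have bound e : e = 1 \/ e = -1 -> e * y k <= 3.
    move=> e1; have := sum_sqr_rows 1 (- s) (- e) 0 i j k i.
    rewrite /= !g_diag !(g_sym _ i) !(g_sym k j) gij c72 d3.
    set q := \sum_k _; have : 0 <= q by apply: sumr_ge0 => l _; apply: sqr_ge0.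
    rewrite /y; clear -s1 e1; move: (g i k) (g j k) => a b.
    by case: s1 => ->; case: e1 => ->; lia.
  have [z gz] := g_parity i k; have [w gw] := g_parity j k.
  have := bound 1 (or_introl erefl); have := bound (-1) (or_intror erefl).
  have : exists v, y k = 2 * v.
    rewrite /y gz gw ij; case: ifP => _; case: s1 => ->.
    - by exists (z - w); ring.
    - by exists (d + z + w); ring.
    - by exists (z - w); ring.
    - by exists (d + z + w + 1); ring.
  by case=> v ->; nia.
apply: (@comb_rows_flat 1 (- s) 0 0 i j i i 2) => // k.
apply: (@sum_ge_eq _ (fun k => y k ^+ 2) (fun => 4)) => //.
by rewrite sumy sumr_const card_ord n72.
Qed.

End Case72.

(** * Ninety vectors of squared norm 3 *)

Section Case90.
Hypotheses (c54 : c = 54) (d3 : d = 3) (n90 : n = 90%N).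

Lemma gram_values_90 i k :
  if col i == col k then g i k ^+ 2 = 1 \/ g i k ^+ 2 = 9
  else g i k = 0 \/ g i k ^+ 2 = 4.
Proof.
have [z] := g_parity i k; have := gram_bound i k; rewrite d3.
move: (g i k) => a; case: ifP => _ bd az.
  suff : a = 1 \/ a = -1 \/ a = 3 \/ a = -3 by case=> [|[|[]]] ->; auto.
  by lia.
suff : a = 0 \/ a = 2 \/ a = -2 by case=> [|[]] ->; auto.
by lia.
Qed.

(** Modulo 4 the squares are 1 within the class and 0 outside, and they add up to 54 * 3 = 4 * 40 +
    2. *)
Lemma class_size_90 i : exists z, class_size i = 4 * z + 2.
Proof.
pose f k := ((g i k ^+ 2 - same_class i k) %/ 4)%Z.
exists (40 - \sum_k f k).
have : \sum_k g i k ^+ 2 = \sum_k (same_class i k + 4 * f k).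
  apply: eq_bigr => k _; have := gram_values_90 i k; rewrite /f /same_class.
  by case: ifP => _ [] ->.
rewrite sum_sqr_row c54 d3 big_split /= -mulr_sumr -/(class_size i).
by move: (class_size i) (\sum_k f k) => a b; lia.
Qed.

(** Two sizes congruent to 2 modulo 4 cannot add up to 90. *)
Lemma one_class_90 i k : col i = col k.
Proof.
apply/eqP/negPn/negP => /class_size_other; rewrite n90.
by have [z ->] := class_size_90 i; have [w ->] := class_size_90 k; lia.
Qed.

Lemma gram_sqr_90 i k : g i k ^+ 2 = 1 + 8 * same_line i k.
Proof.
have := gram_values_90 i k; rewrite (one_class_90 i k) eqxx /same_line d3.
by case=> ->.
Qed.

Lemma line_size_90 i : line_size i = 9.
Proof.
have := sum_sqr_row i; rewrite c54 d3 (eq_bigr _ (fun k _ => gram_sqr_90 i k)).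
by rewrite big_split /= -mulr_sumr -/(line_size i) sumr_const card_ord n90; lia.
Qed.

Lemma line_values_90 s i k : s = 1 \/ s = -1 ->
  same_line i k = 0 /\ (s * g i k = 1 \/ s * g i k = -1) \/
  same_line i k = 1 /\ (s * g i k = 3 \/ s * g i k = -3).
Proof.
move=> s1; have := gram_sqr_90 i k; rewrite /same_line d3; move: (g i k) => a.
case: eqP => _ a2; [right|left]; split=> //.
  suff : a = 3 \/ a = -3 by case: s1 => ->; lia.
  by nia.
suff : a = 1 \/ a = -1 by case: s1 => ->; lia.
by nia.
Qed.

Lemma line_row_90 s t i j k : s = t * g i j ->
  same_line i k = 1 -> s * g i k = 3 * (t * g j k).
Proof.
move=> -> ; rewrite /same_line; case: eqP => // /(parallel j).
by rewrite d3 (g_sym k) mulrCA => -> _; ring.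
Qed.

(* The lines of [i] and [j], oriented by the signs [s] and [t], have inner
   product 1. *)
Definition acute s i t j :=
  [/\ s = 1 \/ s = -1, t = 1 \/ t = -1 & s * (t * g i j) = 1].

Lemma acute_lines s i t j k : acute s i t j ->
  (same_line i k = 1 -> s * g i k = 3 * (t * g j k)) /\
  (same_line j k = 1 -> t * g j k = 3 * (s * g i k)).
Proof.
move=> [s1 t1 st]; split; apply: line_row_90; rewrite ?(g_sym j);
  by case: s1 t1 st => -> [] ->; lia.
Qed.

Lemma acute_new s i k b : s = 1 \/ s = -1 -> b = 1 \/ b = -1 ->
  s * g i k = b -> acute s i b k.
Proof.
by move=> s1 b1 e; split=> //; rewrite mulrCA e; case: b1 => ->.
Qed.

Lemma exists_acute_pair_90 i : exists s j, acute 1 i s j.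
Proof.
have [|j] := @sum_lt_exists _ (same_line i) (fun=> 1).
  by rewrite -/(line_size i) line_size_90 sumr_const card_ord n90.
have one1 : (1 = 1 :> int) \/ (1 = -1 :> int) by left.
have [] := line_values_90 i j one1; last by move=> [->].
by move=> [_ gij] _; exists (1 * g i j), j; apply: acute_new.
Qed.

(** For x = v_i + s v_j the squares <x, v_k>^2 total 54 * 8 = 432, of which the two lines carry only
    16 * 18 = 288. Some k off both lines has <x, v_k> nonzero, so its two signed products agree, and
    their common sign orients its line. *)
Lemma exists_acute_triple_90 i s j : acute 1 i s j ->
  exists t k, acute 1 i t k /\ acute s j t k.
Proof.
move=> ij; have [i1 s1 gij] := ij.
have [|k] := @sum_lt_exists _ (fun k => 16 * (same_line i k + same_line j k))
  (fun k => (1 * g i k + s * g j k + 0 * g i k + 0 * g i k) ^+ 2).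
  rewrite -mulr_sumr big_split /= -/(line_size i) -/(line_size j).
  rewrite !line_size_90 sum_sqr_rows !g_diag (g_sym j i) c54 d3.
  by case: s1 gij => ->; lia.
have := acute_lines k ij; rewrite !mul0r !addr0.
have := line_values_90 i k i1; have := line_values_90 j k s1.
move eA : (1 * g i k) => A; move eB : (s * g j k) => B lB lA ll lt.
have [A1 AB] : (A = 1 \/ A = -1) /\ B = A.
  by case: lB lA ll lt => [][-> [] ->] [][-> [] ->] [] //= h1 h2;
    rewrite ?expr2; lia.
exists A, k; split; apply: acute_new => //.
by rewrite eB.
Qed.

(** The squares for the sum of the three oriented vectors total 54 * 15 = 810. Counting 25 on each
    line and 1 elsewhere gives only 24 * 27 + 90 = 738, so some l off the lines has square 9, that
    is, three equal signs. *)
Lemma exists_acute_quadruple_90 i s j t k :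
  acute 1 i s j -> acute 1 i t k -> acute s j t k ->
  exists u l, [/\ acute 1 i u l, acute s j u l & acute t k u l].
Proof.
move=> ij ik jk; have [i1 s1 gij] := ij; have [_ t1 gik] := ik.
have [_ _ gjk] := jk.
have [|l] := @sum_lt_exists _
  (fun l => 24 * (same_line i l + same_line j l + same_line k l) + 1)
  (fun l => (1 * g i l + s * g j l + t * g k l + 0 * g i l) ^+ 2).
  rewrite big_split /= -mulr_sumr !big_split /=.
  rewrite -/(line_size i) -/(line_size j) -/(line_size k).
  rewrite !line_size_90 sum_sqr_rows !g_diag !(g_sym _ i) (g_sym k j) c54 d3.
  rewrite sumr_const card_ord n90.
  by case: s1 gij gjk => ->; case: t1 gik => ->; lia.
move: (acute_lines l ij) (acute_lines l ik) (acute_lines l jk).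
rewrite !mul0r !addr0.
move: (line_values_90 i l i1) (line_values_90 j l s1) (line_values_90 k l t1).
move eA : (1 * g i l) => A; move eB : (s * g j l) => B.
move eC : (t * g k l) => C lA lB lC fAB fAC fBC lt.
have [A1 BA CA] : [/\ A = 1 \/ A = -1, B = A & C = A].
  by case: lB lA lC fAB fAC fBC lt => [][-> [] ->] [][-> [] ->] [][-> [] ->];
    move=> [h1 h2] [h3 h4] [h5 h6]; rewrite ?expr2; split; lia.
by exists A, l; split; apply: acute_new => //; rewrite ?eB ?eC.
Qed.

Lemma flat_eigenvector_90 : flat_eigenvector.
Proof.
have n0 : (0 < n)%N by rewrite n90.
pose i := Ordinal n0.
have [s [j ij]] := exists_acute_pair_90 i.
have [t [k [ik jk]]] := exists_acute_triple_90 ij.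
have [u [l [il jl kl]]] := exists_acute_quadruple_90 ij ik jk.
have [i1 s1 gij] := ij; have [_ t1 gik] := ik; have [_ _ gjk] := jk.
have [_ u1 gil] := il; have [_ _ gjl] := jl; have [_ _ gkl] := kl.
pose z m := 1 * g i m + s * g j m + t * g k m + u * g l m.
pose lines m := same_line i m + same_line j m + same_line k m + same_line l m.
pose x m := 2 * g i m + (- s) * g j m + (- t) * g k m + (- u) * g l m.
(* On each of the four lines z is 6 or -6. Equality forces z = 0 elsewhere, and then x = 3 v_i - z
   has all its products equal to 3 or -3. *)
have zx m : 36 * lines m <= z m ^+ 2 /\
    (36 * lines m = z m ^+ 2 -> x m ^+ 2 = 9).
  have xz : x m = 3 * (1 * g i m) - z m by rewrite /x /z; ring.
  rewrite xz /z /lines {xz}.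
  move: (acute_lines m ij) (acute_lines m ik) (acute_lines m jk).
  move: (acute_lines m il) (acute_lines m jl) (acute_lines m kl).
  move: (line_values_90 i m i1) (line_values_90 j m s1).
  move: (line_values_90 k m t1) (line_values_90 l m u1).
  move: (1 * g i m) (s * g j m) (t * g k m) (u * g l m) => A B C D.
  (* The four lines are distinct, so five of the sixteen cases survive: [m] is on none of them or on
     exactly one. *)
  case=> [][-> eC]; case=> [][-> eD]; case=> [][-> eA]; case=> [][-> eB];
    move=> [h1 h2] [h3 h4] [h5 h6] [h7 h8] [h9 h10] [h11 h12];
    try by exfalso; clear -eA eB eC eD h1 h2 h3 h4 h5 h6 h7 h8 h9 h10 h11 h12;
      lia.
  - by case: eA => ->; case: eB => ->; case: eC => ->; case: eD => ->.
  - have {}h3 := h3 erefl; have {}h8 := h8 erefl; have {}h11 := h11 erefl.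
    have [-> -> ->] : [/\ A = D, B = 3 * D & C = D]
      by clear -h3 h8 h11; split; lia.
    by have [->|->] : D = 1 \/ D = -1 by clear -eD; lia.
  - have {}h1 := h1 erefl; have {}h7 := h7 erefl; have {}h9 := h9 erefl.
    have [-> -> ->] : [/\ A = 3 * D, B = D & C = D]
      by clear -h1 h7 h9; split; lia.
    by have [->|->] : D = 1 \/ D = -1 by clear -eD; lia.
  - have {}h2 := h2 erefl; have {}h4 := h4 erefl; have {}h6 := h6 erefl.
    have [-> -> ->] : [/\ D = 3 * A, B = A & C = A]
      by clear -h2 h4 h6; split; lia.
    by have [->|->] : A = 1 \/ A = -1 by clear -eA; lia.
  - have {}h5 := h5 erefl; have {}h10 := h10 erefl; have {}h12 := h12 erefl.
    have [-> -> ->] : [/\ A = D, B = D & C = 3 * D]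
      by clear -h5 h10 h12; split; lia.
    by have [->|->] : D = 1 \/ D = -1 by clear -eD; lia.
apply: (@comb_rows_flat 2 (- s) (- t) (- u) i j k l 3) => // m.
(* The sum z has squared norm 24, and 54 * 24 = 36 * (9 + 9 + 9 + 9). *)
apply: (zx m).2; move: m; apply: sum_ge_eq => [m|]; first exact: (zx m).1.
rewrite -mulr_sumr !big_split /= -/(line_size i) -/(line_size j).
rewrite -/(line_size k) -/(line_size l) !line_size_90 sum_sqr_rows !g_diag.
rewrite !(g_sym _ i) (g_sym k j) !(g_sym l) c54 d3.
case: s1 gij gjk gjl {zx x z ij ik jk il jl kl} => ->;
  case: t1 gik gkl => ->; case: u1 gil => ->; lia.
Qed.

End Case90.

End TightGram.

(** * The tight frame of a Seidel matrix *)

Section IntegralSeidel.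
Variables (n : nat) (Z : 'M[int]_n).
Hypotheses (Z_sym : Z^T = Z) (Z_diag : forall i, Z i i = 0)
  (Z_off : forall i j, i != j -> Z i j = 1 \/ Z i j = -1).

Let Zs i j : Z i j = Z j i. Proof. by rewrite -{1}Z_sym mxE. Qed.

Let sum_delta i (a : int) : \sum_(k < n) (if k == i then a else 0) = a.
Proof. by rewrite (bigD1 i) //= eqxx big1 ?addr0 // => k /negPf ->. Qed.

Definition row_sum i := \sum_k Z i k.

Lemma row_sum_parity i : exists h, row_sum i = n%:Z - 1 + 2 * h.
Proof.
pose h k := if Z i k == -1 then -1 else 0 : int.
exists (\sum_k h k).
rewrite /row_sum (eq_bigr (fun k => 1 + 2 * h k - (if k == i then 1 else 0))).
  rewrite sumrB big_split /= -mulr_sumr sum_delta.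
  by rewrite sumr_const card_ord; move: (\sum_k h k) => a; lia.
move=> k _; rewrite /h; have [->|ki] := eqVneq k i; first by rewrite Z_diag.
by rewrite eq_sym in ki; case: (Z_off ki) => ->.
Qed.

Lemma seidel_sqr_diag i : (Z *m Z) i i = n%:Z - 1.
Proof.
rewrite mxE (eq_bigr (fun k => 1 - (if k == i then 1 else 0))) => [|k _].
  by rewrite sumrB sum_delta sumr_const card_ord; lia.
have [->|ki] := eqVneq k i; first by rewrite Z_diag.
by rewrite (Zs k); rewrite eq_sym in ki; case: (Z_off ki) => ->.
Qed.

(* Two odd integers a, b satisfy a * b = a + b - 1 modulo 4. *)
Lemma seidel_sqr_off i j : i != j -> exists w,
  (Z *m Z) i j = row_sum i + row_sum j - n%:Z + 2 * (1 - Z i j) + 4 * w.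
Proof.
move=> ij; pose f k := if (Z i k == -1) && (Z k j == -1) then 1 else 0 : int.
exists (\sum_k f k).
(* The two conditional terms correct the indices [i] and [j], where a diagonal zero breaks the
   congruence; [f] marks two factors -1, whose product 1 exceeds -1 - 1 - 1 by 4. *)
rewrite mxE (eq_bigr (fun k => Z i k + Z j k - 1
  + (if k == i then 1 - Z i j else 0) + (if k == j then 1 - Z i j else 0)
  + 4 * f k)).
  rewrite !big_split /= -mulr_sumr !sum_delta.
  rewrite sumr_const card_ord -/(row_sum i) -/(row_sum j).
  by move: (\sum_k f k) => a; lia.
move=> k _; rewrite /f (Zs j k); have [->|ki] := eqVneq k i.
  by rewrite (negPf ij) Z_diag; case: (Z_off ij) => ->.
have [->|kj] := eqVneq k j; first by rewrite Z_diag; case: (Z_off ij) => ->.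
rewrite eq_sym in ki.
by case: (Z_off ki) => ->; case: (Z_off kj) => ->.
Qed.

Variables (b t e c d : int).
Let M := (Z + 5%:M) *m (Z - b%:M).
Hypotheses (e1 : e = 1 \/ e = -1)
  (n_even : exists h, n%:Z = 2 * h) (b_odd : exists h, b = 2 * h + 1)
  (d_def : n%:Z - 1 - 5 * b = 2 * e * d).

(** The sign [e] is that of (t + 5)(t - b) and makes the form positive; the division is exact by
    [gram_spec]. *)
Definition gram i j : int := (e * M i j %/ 2)%Z.
Definition row_class i := (row_sum i %% 4)%Z == 1.

Lemma row_class_spec i : exists m,
  row_sum i = 1 + 4 * m + (if row_class i then 0 else 2).
Proof.
have [h ri] := row_sum_parity i; have [hn n2] := n_even.
exists (row_sum i %/ 4)%Z; rewrite /row_class.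
by move: (row_sum i) ri => r ri; case: eqP; lia.
Qed.

Lemma ME i j : M i j = (Z *m Z) i j + (5 - b) * Z i j - 5 * b * (i == j)%:R.
Proof.
rewrite /M mulmxDl !mulmxDr !mulmxN mul_mx_scalar mul_scalar_mx.
rewrite -scalar_mxM !mxE; case: (i == j); rewrite ?mulr1n ?mulr0n; ring.
Qed.

Lemma M_sym i j : M i j = M j i.
Proof.
rewrite !ME eq_sym (Zs j); congr (_ + _ - _).
by rewrite -{1 2}Z_sym -trmx_mul mxE.
Qed.

(** Modulo 4, neither (5 - b) Z_ij nor 2(1 - Z_ij) depends on the sign of Z_ij, so off the diagonal
    M_ij depends only on the two row sums; comparison with the diagonal value n - 1 - 5b = 2ed
    leaves 0 or 2. *)
Lemma gram_spec i j : exists z,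
  e * M i j = 2 * (d + 2 * z + (if row_class i == row_class j then 0 else 1)).
Proof.
rewrite ME; have [<-|ij] := eqVneq i j.
  exists 0; rewrite eqxx seidel_sqr_diag Z_diag.
  by case: e1 d_def => ->; lia.
have [w ->] := seidel_sqr_off ij.
have [mi ->] := row_class_spec i; have [mj ->] := row_class_spec j.
have [hn n2] := n_even; have [hb b2] := b_odd.
have [z ->] : exists z, (5 - b) * Z i j = 5 - b + 4 * z.
  by case: (Z_off ij) => ->; [exists 0 | exists (hb - 2)]; lia.
set X := (X in e * X).
suff [z' XE] : exists z', e * X = 2 * d +
  (if row_class i == row_class j then 0 else 2) + 4 * z'.
  by exists z'; rewrite XE; case: ifP => _; lia.
exists ((e * X - (2 * d + (if row_class i == row_class j then 0 else 2)))
   %/ 4)%Z.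
rewrite /X {X} /=; case: (row_class i) => /=; case: (row_class j) => /=;
  case: e1 d_def => ->; case: (Z_off ij) => ->; lia.
Qed.

Lemma gramE i j : 2 * gram i j = e * M i j.
Proof.
have [z eM] := gram_spec i j; rewrite /gram eM.
by rewrite mulrC divzK // dvdz_mulr.
Qed.

Lemma gram_parity i j : exists z,
  gram i j = d + 2 * z + (if row_class i == row_class j then 0 else 1).
Proof. by have [z eM] := gram_spec i j; exists z; have := gramE i j; lia. Qed.

Lemma gram_diag i : gram i i = d.
Proof.
have := gramE i i; rewrite ME eqxx seidel_sqr_diag Z_diag.
by case: e1 d_def => ->; lia.
Qed.

Lemma gram_sym i j : gram i j = gram j i.
Proof. by rewrite /gram M_sym. Qed.

Hypotheses (MZ : M *m Z = t *: M) (c_def : (t + 5) * (t - b) = 2 * e * c)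
  (c_gt0 : 0 < c).

Lemma sqr_affine : M *m M = (2 * e * c) *: M.
Proof.
have MZa a : M *m (Z + a%:M) = (t + a) *: M.
  by rewrite mulmxDr MZ mul_mx_scalar scalerDl.
rewrite {2}/M mulmxA MZa -scalemxAl -raddfN MZa scalerA.
by rewrite c_def.
Qed.

Lemma gram_tight i j : \sum_k gram i k * gram j k = c * gram i j.
Proof.
have four0 : 4 != 0 :> int by [].
apply: (mulfI four0); rewrite mulr_sumr.
have -> : 4 * (c * gram i j) = 2 * e * c * M i j.
  have -> : 4 * (c * gram i j) = 2 * c * (2 * gram i j) by ring.
  by rewrite gramE; ring.
have /matrixP/(_ i j) := sqr_affine.
rewrite [LHS]mxE [RHS]mxE => <-; apply: eq_bigr => k _.
have -> : 4 * (gram i k * gram j k) = 2 * gram i k * (2 * gram j k) by ring.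
by rewrite !gramE (M_sym k j); case: e1 => ->; ring.
Qed.

(** A c-eigenvector y of [gram] satisfies y M = 2ec y; multiplying by Z and using M Z = t M yields y
    Z = t y after cancelling 2ec. *)
Lemma flat_eigenvector_seidel : flat_eigenvector c gram ->
  exists y : 'rV[int]_n, exists tau,
    [/\ tau != 0, forall k, y 0 k ^+ 2 = tau ^+ 2 & y *m Z = t *: y].
Proof.
move=> [y [tau [tau0 ytau yg]]].
exists (\row_k y k), tau; split=> // [k|]; first by rewrite mxE.
set v := \row_k y k.
have vM : v *m M = (2 * e * c) *: v.
  apply/rowP=> i; rewrite mxE [RHS]mxE [v 0 i]mxE.
  have -> : 2 * e * c * y i = 2 * e * (c * y i) by ring.
  rewrite -yg mulr_sumr; apply: eq_bigr => k _; rewrite [v 0 k]mxE.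
  have -> : 2 * e * (gram i k * y k) = e * y k * (2 * gram i k) by ring.
  by rewrite gramE (M_sym k i); case: e1 => ->; ring.
have k0 : 2 * e * c != 0.
  by rewrite !mulf_neq0 //; [case: e1 => -> | move: c_gt0; case: ltgtP].
apply: (scalemx_inj k0).
by rewrite scalemxAl -vM -mulmxA MZ -scalemxAr vM !scalerA mulrC.
Qed.

End IntegralSeidel.

(** * Transfer between real and integer matrices *)

Lemma seidel_intmx (R : realType) n (S : 'M[R]_n) : seidel_matrix S ->
  exists Z : 'M[int]_n, [/\ S = map_mx intr Z, Z^T = Z, forall i, Z i i = 0
    & forall i j, i != j -> Z i j = 1 \/ Z i j = -1].
Proof.
move=> seS; have [symS ent d0 nz] := seS.
exists (\matrix_(i, j) if i == j then 0 else if S i j == 1 then 1 else -1).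
split=> [||i|i j ij].
- apply/matrixP=> i j; rewrite !mxE; have [->|ij] := eqVneq i j.
    by rewrite d0.
  by case: (seidel_entry seS ij) => ->; rewrite ?eqxx // eqNr oner_eq0.
- by apply/matrixP=> i j; rewrite !mxE eq_sym -{1}symS mxE.
- by rewrite mxE eqxx.
- by rewrite mxE (negPf ij); case: ifP; auto.
Qed.

(** The product (S + 5)(S - b)(S - t) kills all eigenspaces, which span; as [intr] is injective, the
    same product vanishes for [Z]. *)
Lemma annihilated_of_spectrum (R : realType) n (Z : 'M[int]_n)
    (S := map_mx intr Z : 'M[R]_n) (s : seq (R * nat)) (b t : int) :
  Z^T = Z -> has_spectrum S s ->
  {subset unzip1 s <= [:: -5; b%:~R; t%:~R]} ->
  (Z + 5%:M) *m (Z - b%:M) *m Z = t *: ((Z + 5%:M) *m (Z - b%:M)).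
Proof.
move=> symZ sS sub3; have symS : S^T = S by rewrite map_trmx symZ.
pose N := (Z + 5%:M) *m (Z - b%:M) *m (Z - t%:M).
suff /eqP : N = 0.
  by rewrite /N mulmxBr subr_eq0 mul_mx_scalar => /eqP.
suff N0 : map_mx intr N = 0 :> 'M[R]_n.
  apply/matrixP=> i j; have /matrixP/(_ i j)/eqP := N0.
  by rewrite [map_mx _ _ _ _]mxE !mxE intr_eq0 => /eqP.
have mapB a : map_mx intr (Z + a%:M) = S + (a%:~R)%:M :> 'M[R]_n.
  by rewrite map_mxD map_scalar_mx.
rewrite /N !map_mxM -!raddfN !mapB.
set P := _ *m _ *m _.
have kerP : (1%:M <= kermx P)%MS.
  apply: submx_trans (has_spectrum_sum_eigenspace symS sS) _.
  rewrite (big_nth 0) big_mkord; apply/sumsmx_subP => i _.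
  move: (sub3 _ (mem_nth 0 (ltn_ord i))); move: (nth _ _ _) => a a3.
  have shift r : eigenspace S a *m (S + r%:M) = (a + r) *: eigenspace S a.
    rewrite mulmxDr mul_mx_scalar scalerDl.
    by have /eigenspaceP -> := submx_refl (eigenspace S a).
  apply/sub_kermxP; rewrite /P !mulmxA !(shift, =^~ scalemxAl) !scalerA.
  move: a3; rewrite !inE => /or3P[]/eqP ->; rewrite !mulrNz.
  - by rewrite addNr !(mulr0, mul0r) scale0r.
  - by rewrite subrr !(mulr0, mul0r) scale0r.
  - by rewrite subrr !(mulr0, mul0r) scale0r.
by move/sub_kermxP: kerP; rewrite mul1mx.
Qed.

Lemma switching_vector (R : realType) n (S : 'M[R]_n) (s : seq (R * nat))
    (b t e c d : int) :
  seidel_matrix S -> has_spectrum S s ->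
  {subset unzip1 s <= [:: -5; b%:~R; t%:~R]} ->
  e = 1 \/ e = -1 -> (exists h, n%:Z = 2 * h) -> (exists h, b = 2 * h + 1) ->
  (t + 5) * (t - b) = 2 * e * c -> n%:Z - 1 - 5 * b = 2 * e * d -> 0 < c ->
  (forall (g : 'I_n -> 'I_n -> int) (col : 'I_n -> bool),
    0 < c ->
    (forall i j, g i j = g j i) -> (forall i, g i i = d) ->
    (forall i j, \sum_k g i k * g j k = c * g i j) ->
    (forall i j, exists z,
       g i j = d + 2 * z + (if col i == col j then 0 else 1)) ->
    flat_eigenvector c g) ->
  exists x : 'rV[R]_n,
    (forall i, x 0 i ^+ 2 = 1) /\ x *m S = t%:~R *: x.
Proof.
move=> seS sS sub3 e1 n2 b2 cE dE c0 flat.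
have [Z [defS symZ Z0 Zpm]] := seidel_intmx seS; rewrite defS in sS.
have MZ := annihilated_of_spectrum symZ sS sub3.
have [|y [tau [tau0 ytau yZ]]] :=
    flat_eigenvector_seidel symZ Z0 Zpm e1 n2 b2 dE MZ c0.
  apply: (flat _ (row_class Z)) => //.
  - exact: gram_sym.
  - exact: (gram_diag symZ Z0 Zpm e1 n2 b2 dE).
  - exact: (gram_tight symZ Z0 Zpm e1 n2 b2 dE MZ cE).
  - exact: (gram_parity symZ Z0 Zpm e1 n2 b2 dE).
exists (tau%:~R^-1 *: map_mx intr y); split=> [i|].
  rewrite !mxE exprMn exprVn -!rmorphXn /= ytau mulVf //.
  by rewrite intr_eq0 expf_neq0.
rewrite defS -scalemxAl -map_mxM yZ map_mxZ /= !scalerA mulrC.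
by [].
Qed.

(** * The parameters of the three pairs of spectra *)

Theorem mainTheorem2 (R : realType) :
  [/\ (exists (n : nat) (S : 'M[R]_n), seidel_matrix S /\
         has_spectrum S [:: (-5, 42%N); (11, 15%N); (15, 3%N)])
      <->
      (exists G : sgraph,
         has_spectrum (adjacency_matrix R G)
           [:: (22, 1%N); (2, 42%N); (-6, 15%N); (-8, 2%N)]),
      (exists (n : nat) (S : 'M[R]_n), seidel_matrix S /\
         has_spectrum S [:: (-5, 53%N); (13, 16%N); (19, 3%N)])
      <->
      (exists G : sgraph,
         has_spectrum (adjacency_matrix R G)
           [:: (26, 1%N); (2, 53%N); (-7, 16%N); (-10, 2%N)])
    & (exists (n : nat) (S : 'M[R]_n), seidel_matrix S /\
         has_spectrum S [:: (-5, 70%N); (13, 5%N); (19, 15%N)])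
      <->
      (exists G : sgraph,
         has_spectrum (adjacency_matrix R G)
           [:: (38, 1%N); (2, 70%N); (-7, 4%N); (-10, 15%N)])].
Proof.
split; split.
- move=> [n [S [seS sS]]]; have [symS _ _ _] := seS.
  have nE : n = 60%N.
    by rewrite -(has_spectrum_size symS sS) !big_cons big_nil.
  (* (15 + 5)(15 - 11) = 2 * 40 and 60 - 1 - 5 * 11 = 2 * 2. *)
  have [||||||||x [x1 xS]] :=
    @switching_vector R n S _ 11 15 1 40 2 seS sS.
  + by move=> a; rewrite !inE => /or3P[] ->; rewrite ?orbT.
  + by left.
  + by exists 30; rewrite nE.
  + by exists 5.
  + by [].
  + by rewrite nE.
  + by [].
  + move=> g col c0 gs gd gt gp.
    exact: (flat_eigenvector_60 c0 gs gd gt gp).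
  have {}sS : has_spectrum S [:: (15, 3%N); (-5, 42%N); (11, 15%N)].
    by apply: has_spectrum_perm sS; apply/permP => p /=; lia.
  have [//||G sG] := graph_spectrum_of_seidel seS sS _ _ x1 xS.
    by move=> a; rewrite !inE nE => /or3P[]/eqP-> /=; lra.
  exists G; have {}sG : has_spectrum (adjacency_matrix R G)
    [:: (22, 1%N); (-8, 2%N); (2, 42%N); (-6, 15%N)].
    move: sG; rewrite nE /=; congr (has_spectrum _ _).
    by do ![congr (_ :: _) | congr (_, _)]; lra.
  by apply: has_spectrum_perm sG; apply/permP => p /=; lia.
- move=> [G sG].
  have nE : #|G| = 60%N.
    rewrite -(has_spectrum_size (adjacency_matrix_sym R G) sG).
    by rewrite !big_cons big_nil.
  (* The eigenvalue -8 follows 22 because 60 = 2(22 + 8): both yield the Seidel eigenvalue 15. *)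
  have {}sG : has_spectrum (adjacency_matrix R G)
    [:: (22, 1%N); (-8, 2%N); (2, 42%N); (-6, 15%N)].
    by apply: has_spectrum_perm sG; apply/permP => p /=; lia.
  have [|||S [seS sS]] := seidel_spectrum_of_graph sG.
  + by move=> a; rewrite !inE => /or3P[]/eqP-> /=; lra.
  + by rewrite nE !big_cons big_nil /=; lra.
  + by rewrite nE; lra.
  have {}sS : has_spectrum S [:: (15, 3%N); (-5, 42%N); (11, 15%N)].
    move: sS => /=; congr (has_spectrum _ _).
    by do ![congr (_ :: _) | congr (_, _)]; lra.
  exists #|G|, S; split=> //.
  by apply: has_spectrum_perm sS; apply/permP => p /=; lia.
- move=> [n [S [seS sS]]]; have [symS _ _ _] := seS.
  have nE : n = 72%N.
    by rewrite -(has_spectrum_size symS sS) !big_cons big_nil.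
  (* (19 + 5)(19 - 13) = 2 * 72 and 72 - 1 - 5 * 13 = 2 * 3. *)
  have [||||||||x [x1 xS]] :=
    @switching_vector R n S _ 13 19 1 72 3 seS sS.
  + by move=> a; rewrite !inE => /or3P[] ->; rewrite ?orbT.
  + by left.
  + by exists 36; rewrite nE.
  + by exists 6.
  + by [].
  + by rewrite nE.
  + by [].
  + move=> g col c0 gs gd gt gp.
    exact: (flat_eigenvector_72 c0 gs gd gt gp).
  have {}sS : has_spectrum S [:: (19, 3%N); (-5, 53%N); (13, 16%N)].
    by apply: has_spectrum_perm sS; apply/permP => p /=; lia.
  have [//||G sG] := graph_spectrum_of_seidel seS sS _ _ x1 xS.
    by move=> a; rewrite !inE nE => /or3P[]/eqP-> /=; lra.
  exists G; have {}sG : has_spectrum (adjacency_matrix R G)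
    [:: (26, 1%N); (-10, 2%N); (2, 53%N); (-7, 16%N)].
    move: sG; rewrite nE /=; congr (has_spectrum _ _).
    by do ![congr (_ :: _) | congr (_, _)]; lra.
  by apply: has_spectrum_perm sG; apply/permP => p /=; lia.
- move=> [G sG].
  have nE : #|G| = 72%N.
    rewrite -(has_spectrum_size (adjacency_matrix_sym R G) sG).
    by rewrite !big_cons big_nil.
  have {}sG : has_spectrum (adjacency_matrix R G)
    [:: (26, 1%N); (-10, 2%N); (2, 53%N); (-7, 16%N)].
    by apply: has_spectrum_perm sG; apply/permP => p /=; lia.
  have [|||S [seS sS]] := seidel_spectrum_of_graph sG.
  + by move=> a; rewrite !inE => /or3P[]/eqP-> /=; lra.
  + by rewrite nE !big_cons big_nil /=; lra.
  + by rewrite nE; lra.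
  have {}sS : has_spectrum S [:: (19, 3%N); (-5, 53%N); (13, 16%N)].
    move: sS => /=; congr (has_spectrum _ _).
    by do ![congr (_ :: _) | congr (_, _)]; lra.
  exists #|G|, S; split=> //.
  by apply: has_spectrum_perm sS; apply/permP => p /=; lia.
- move=> [n [S [seS sS]]]; have [symS _ _ _] := seS.
  have nE : n = 90%N.
    by rewrite -(has_spectrum_size symS sS) !big_cons big_nil.
  (* Here t = 13 lies below b = 19, which makes the sign negative: (13 + 5)(13 - 19) = -2 * 54 and
     90 - 1 - 5 * 19 = -2 * 3. *)
  have [||||||||x [x1 xS]] :=
    @switching_vector R n S _ 19 13 (-1) 54 3 seS sS.
  + by move=> a; rewrite !inE => /or3P[] ->; rewrite ?orbT.
  + by right.
  + by exists 45; rewrite nE.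
  + by exists 9.
  + by [].
  + by rewrite nE.
  + by [].
  + move=> g col c0 gs gd gt gp.
    exact: (flat_eigenvector_90 c0 gs gd gt gp).
  have {}sS : has_spectrum S [:: (13, 5%N); (-5, 70%N); (19, 15%N)].
    by apply: has_spectrum_perm sS; apply/permP => p /=; lia.
  have [//||G sG] := graph_spectrum_of_seidel seS sS _ _ x1 xS.
    by move=> a; rewrite !inE nE => /or3P[]/eqP-> /=; lra.
  exists G; have {}sG : has_spectrum (adjacency_matrix R G)
    [:: (38, 1%N); (-7, 4%N); (2, 70%N); (-10, 15%N)].
    move: sG; rewrite nE /=; congr (has_spectrum _ _).
    by do ![congr (_ :: _) | congr (_, _)]; lra.
  by apply: has_spectrum_perm sG; apply/permP => p /=; lia.
- move=> [G sG].
  have nE : #|G| = 90%N.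
    rewrite -(has_spectrum_size (adjacency_matrix_sym R G) sG).
    by rewrite !big_cons big_nil.
  have {}sG : has_spectrum (adjacency_matrix R G)
    [:: (38, 1%N); (-7, 4%N); (2, 70%N); (-10, 15%N)].
    by apply: has_spectrum_perm sG; apply/permP => p /=; lia.
  have [|||S [seS sS]] := seidel_spectrum_of_graph sG.
  + by move=> a; rewrite !inE => /or3P[]/eqP-> /=; lra.
  + by rewrite nE !big_cons big_nil /=; lra.
  + by rewrite nE; lra.
  have {}sS : has_spectrum S [:: (13, 5%N); (-5, 70%N); (19, 15%N)].
    move: sS => /=; congr (has_spectrum _ _).
    by do ![congr (_ :: _) | congr (_, _)]; lra.
  exists #|G|, S; split=> //.
  by apply: has_spectrum_perm sS; apply/permP => p /=; lia.
Qed.
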